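(* Let $n=2k+1\ge3$ and let $\mathcal F_1,\mathcal F_2$ be families of convex compact sets in $\mathbb R^n$. Then at least one of the following holds: 1) there exist $K_1\in\mathcal F_1$ and $K_2\in\mathcal F_2$ with $K_1\cap K_2=\emptyset$; 2) for some $i\in\{1,2\}$, any $k+2$ or fewer sets of $\mathcal F_i$ have a common $k$-transversal.
   Context: A $k$-flat is a $k$-dimensional affine subspace of $\mathbb R^n$; it is a common $k$-transversal of a family of sets if it intersects every set of the family. *)

(* Defs.v *)
From mathcomp Require Import all_boot all_order all_algebra.
From mathcomp Require Import all_classical all_reals all_analysis.

Set Implicit Arguments.
Unset Strict Implicit.
Unset Printing Implicit Defensive.

Import GRing.Theory.

Local Open Scope classical_set_scope.
Local Open Scope ring_scope.

Definition is_flat (R : realType) (n k : nat) (L : set 'rV[R]_n) : Prop :=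
  exists (p : 'rV[R]_n) (V : {vspace 'rV[R]_n}),
    \dim V = k /\ L = [set p + v | v in [set v | v \in V]].

Definition is_common_transversal (R : realType) (n k : nat)
    (G : set (set 'rV[R]_n)) (L : set 'rV[R]_n) : Prop :=
  is_flat k L /\ forall K, G K -> L `&` K !=set0.

(* [G #<= `I_m] says that [G] has at most [m] members. *)
Definition every_subfamily_has_transversal (R : realType) (n k m : nat)
    (F : set (set 'rV[R]_n)) : Prop :=
  forall G : set (set 'rV[R]_n), G `<=` F -> (G #<= `I_m)%card ->
    exists L, is_common_transversal k G L.

(* Main.v *)
Require Import Defs.
From mathcomp Require Import all_boot all_order all_algebra.
From mathcomp Require Import all_classical all_reals all_analysis.
From mathcomp Require Import fingroup perm ring lra zify.

(* Suppose that every member of one family meets every member of the other, and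
   that each family contains [k + 2] or fewer members without a common
   [k]-transversal. Choose points [x i j] in the intersections of these members,
   repeated if necessary, and lift them to vectors [y i j = (x i j, 1)]
   of dimension [2k + 2]. A transversal of the first members is a nontrivial
   linear relation between the [y i j] whose coefficients have constant sign on
   each row [i], so by Gordan's alternative every choice of row signs is
   realized strictly by a linear functional, and likewise for columns. These
   functionals, interpolated over chains of sign vectors, give odd maps [f], [g]
   on two spheres of dimension [k + 1]; on their join, [f - g] and one more odd
   function, which forces both signs to occur among the rows, make [2k + 3] odd
   functions, hence have a common zero by a discrete Borsuk-Ulam theorem. But a
   functional cannot be positive on one row, negative on another, and of strict
   sign on a column. *)

Set Implicit Arguments.
Unset Strict Implicit.
Unset Printing Implicit Defensive.

Import Order.TTheory GRing.Theory Num.Theory.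
Import numFieldNormedType.Exports.

Local Open Scope ring_scope.

(** * Gordan's alternative *)

(** Either list may be empty, so [t] is built by induction rather than as the midpoint of a maximum
    and a minimum. *)
Lemma exists_between (F : realFieldType) (A B : seq F) :
  (forall a b, a \in A -> b \in B -> a < b) ->
  exists t, (forall a, a \in A -> a < t) /\ (forall b, b \in B -> t < b).
Proof.
have lt_all (M : F) (C : seq F) : (forall b, b \in C -> M < b) ->
    exists2 t, M < t & forall b, b \in C -> t < b.
  elim: C => [|c C IH] H; first by exists (M + 1); rewrite ?ltrDl.
  have [|t Mt tC] := IH; first by move=> b bC; apply: H; rewrite inE bC orbT.
  have Mc : M < c by apply: H; rewrite inE eqxx.
  have [tc|ct] := ltrP t c.
    by exists t => // b; rewrite inE => /predU1P[->|/tC].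
  exists ((M + c) / 2); first by lra.
  by move=> b; rewrite inE => /predU1P[->|/tC]; lra.
elim: A => [_|a A IH H].
  suff [t tB] : exists t, forall b, b \in B -> t < b by exists t.
  elim: B => [|c B [t tB]]; first by exists 0.
  exists (Num.min t (c - 1)) => b; rewrite inE gt_min => /predU1P[->|/tB ->//].
  by rewrite gtrDl ltrN10 orbT.
have [|t [tA tB]] := IH; first by move=> x b xA; apply: H; rewrite inE xA orbT.
have [|u ut uB] := @lt_all (Num.max a t) B.
  by move=> b bB; rewrite gt_max tB // H // inE eqxx.
move: ut; rewrite gt_max => /andP[au tu]; exists u; split=> // b.
by rewrite inE => /predU1P[->//|/tA]; move/lt_trans; apply.
Qed.

(* Fourier-Motzkin elimination of one coordinate at a time; quantifying over
   the convex cones [K] replaces explicit nonnegative combinations. *)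
Lemma gordan_cone (F : realFieldType) (n d : nat) (s : seq 'rV[F]_n) :
  (d <= n)%N ->
  (exists y : 'rV[F]_n,
     forall h, h \in s -> 0 < \sum_(j < n | (j < d)%N) h 0 j * y 0 j) \/
  (forall K : 'rV[F]_n -> Prop,
     (forall a b u w, 0 < a -> 0 < b -> K u -> K w -> K (a *: u + b *: w)) ->
     (forall h, h \in s -> K h) ->
     exists2 z, K z & forall j : 'I_n, (j < d)%N -> z 0 j = 0).
Proof.
elim: d s => [|d IH] s dn.
  case: s => [|h s]; [by left; exists 0 | right => K _ Ks].
  by exists h => //; apply: Ks; rewrite inE eqxx.
pose e := Ordinal dn.
have sumE (h y : 'rV[F]_n) : \sum_(j < n | (j < d.+1)%N) h 0 j * y 0 j =
    h 0 e * y 0 e + \sum_(j < n | (j < d)%N) h 0 j * y 0 j.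
  rewrite (bigD1 e) //=; congr (_ + _); apply: eq_bigl => j.
  by rewrite -val_eqE /=; lia.
pose P := [seq h : 'rV_n <- s | 0 < h 0 e].
pose N := [seq h : 'rV_n <- s | h 0 e < 0].
pose Z := [seq h : 'rV_n <- s | h 0 e == 0].
(* Positive weights for [u] in [P] and [w] in [N], chosen to cancel coordinate [e]. *)
pose comb (u w : 'rV[F]_n) := (- w 0 e) *: u + u 0 e *: w.
have [[y yP]|right_alt] := IH (Z ++ [seq comb u w | u <- P, w <- N]) (ltnW dn).
  left; pose S (h : 'rV[F]_n) := \sum_(j < n | (j < d)%N) h 0 j * y 0 j.
  (* The new coordinate [t] is bounded below by [P] and above by [N]; the bounds are compatible
     because [y] is positive on every [comb u w]. *)
  have [|t [tP tN]] := @exists_between F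
      [seq - S u / u 0 e | u <- P] [seq S w / - w 0 e | w <- N].
    move=> _ _ /mapP[u uP ->] /mapP[w wN ->].
    have : 0 < S (comb u w).
      by apply: yP; rewrite mem_cat; apply/orP; right; apply: allpairs_f.
    have -> : S (comb u w) = - w 0 e * S u + u 0 e * S w.
      rewrite /S !mulr_sumr -big_split; apply: eq_bigr => j _ /=.
      by rewrite !mxE; ring.
    move: uP wN; rewrite !mem_filter => /andP[u0 _] /andP[w0 _].
    rewrite ltr_pdivrMr // mulrAC ltr_pdivlMr ?oppr_gt0 //; lra.
  pose y' : 'rV[F]_n := \row_j if j == e then t else y 0 j.
  exists y' => h hs; rewrite sumE.
  have -> : \sum_(j < n | (j < d)%N) h 0 j * y' 0 j = S h.
    apply: eq_bigr => j jd; rewrite !mxE ifF //.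
    by apply/negbTE; rewrite -val_eqE /= neq_ltn jd.
  rewrite mxE eqxx; case: (ltrgtP (h 0 e) 0) => h0.
  - have /tN : S h / - h 0 e \in [seq S w / - w 0 e | w <- N].
      by apply: map_f; rewrite mem_filter h0.
    rewrite ltr_pdivlMr ?oppr_gt0 //; lra.
  - have /tP : - S h / h 0 e \in [seq - S u / u 0 e | u <- P].
      by apply: map_f; rewrite mem_filter h0.
    rewrite ltr_pdivrMr //; lra.
  - by rewrite h0 mul0r add0r; apply: yP; rewrite mem_cat mem_filter h0 eqxx hs.
right=> K Kcone Ks.
have [] := right_alt (fun z => K z /\ z 0 e = 0).
- move=> a b u w a0 b0 [Ku u0] [Kw w0]; split; first exact: Kcone.
  by rewrite !mxE u0 w0 !mulr0 addr0.
- move=> h; rewrite mem_cat => /orP[|/allpairsP[[u w] /= [uP wN ->]]].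
    by rewrite mem_filter => /andP[/eqP h0 hs]; split=> //; apply: Ks.
  move: uP wN; rewrite !mem_filter => /andP[u0 us] /andP[w0 ws].
  split; last by rewrite !mxE; ring.
  by apply: Kcone; rewrite ?oppr_gt0 //; apply: Ks.
- move=> z [Kz z0] zd; exists z => // j; rewrite ltnS leq_eqVlt.
  by case/orP=> [/eqP jd|/zd//]; rewrite (_ : j = e) //; apply: val_inj.
Qed.

Lemma gordan (F : realFieldType) (n : nat) (I : finType) (P : pred I)
    (h : I -> 'rV[F]_n) :
  (exists y : 'rV[F]_n, forall i, P i -> 0 < \sum_j h i 0 j * y 0 j) \/
  (exists l : I -> F, [/\ forall i, 0 <= l i, forall i, ~~ P i -> l i = 0,
     exists i, l i != 0 & \sum_i l i *: h i = 0]).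
Proof.
have [[y yP]|alt] := @gordan_cone F n n [seq h i | i <- enum P] (leqnn n).
  left; exists y => i Pi.
  have /yP : h i \in [seq h i | i <- enum P] by apply: map_f; rewrite mem_enum.
  by rewrite big_mkcond; under eq_bigr => j _ do rewrite ltn_ord.
right.
(* Nontriviality can be carried along in the cone because nonnegative coefficients do not cancel. *)
have [] := alt (fun z => exists l : I -> F, [/\ forall i, 0 <= l i,
    forall i, ~~ P i -> l i = 0, exists i, l i != 0 & \sum_i l i *: h i = z]).
- move=> a b _ _ a0 b0 [l [l0 lP [i li] <-]] [m [m0 mP _ <-]].
  exists (fun i => a * l i + b * m i); split.
  + by move=> t; rewrite addr_ge0 // mulr_ge0 // ltW.
  + by move=> t nPt; rewrite lP // mP // !mulr0 addr0.
  + exists i; rewrite gt_eqF // ltr_pwDl ?mulr_ge0 ?(ltW b0) //.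
    by rewrite mulr_gt0 // lt_neqAle eq_sym li l0.
  + rewrite !scaler_sumr -big_split; apply: eq_bigr => t _ /=.
    by rewrite scalerDl !scalerA.
- move=> u /mapP[i]; rewrite mem_enum => Pi ->.
  exists (fun t => (t == i)%:R); split=> [t|t nPt||]; rewrite ?ler0n //.
  + by case: eqP nPt => // -> /negP[].
  + by exists i; rewrite eqxx oner_eq0.
  + rewrite (bigD1 i) //= eqxx scale1r big1 ?addr0 // => t /negbTE ->.
    by rewrite scale0r.
- move=> z [l [l0 lP li lz]] z0; exists l; split=> //; rewrite lz.
  by apply/rowP => j; rewrite z0 // mxE.
Qed.

(** * Edges of planar cones *)

Section PlanarCone.
Variables (F : realFieldType) (I : finType).

Let det2 (p q : I -> F) i j := p i * q j - q i * p j.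

(* Seen from a vector having all the others on its left, the others are
   linearly ordered by angle. *)
Lemma leftmost_rightmost (p q : I -> F) (i : I) : (1 < #|I|)%N ->
  (forall i j, i != j -> det2 p q i j != 0) ->
  (forall j, j != i -> 0 < det2 p q i j) ->
  exists l, forall j, j != l -> det2 p q l j < 0.
Proof.
move=> I_gt1 D0 iP.
have [k ki] : exists k, k != i.
  have : (0 < #|predC1 i|)%N by rewrite cardC1; case: #|I| I_gt1 => [|[]].
  by case/card_gt0P => k; exists k.
(* Among vectors on the left of [i] this ratio grows with the angle from [i]. *)
have [l li lmax] := @Order.TotalTheory.arg_maxP _ F I k (fun j => j != i)
  (fun j => det2 p q k j / det2 p q i j) ki.
exists l => j jl; have [->|ji] := eqVneq j i.
  have := iP _ li; rewrite /det2; lra.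
have := lmax j ji; rewrite /= ler_pdivrMr ?iP // mulrAC ler_pdivlMr ?iP //.
(* The three-term Plücker relation for four planar vectors. *)
have -> : det2 p q k l * det2 p q i j =
    det2 p q k j * det2 p q i l - det2 p q i k * det2 p q l j.
  by rewrite /det2; ring.
move=> le; rewrite lt_neqAle D0 1?eq_sym //= -(pmulr_rle0 _ (iP _ ki)); lra.
Qed.

(* The vectors [(p i, q i)] are linear forms on the plane, and the cone is where
   all of them are nonnegative. *)
Definition is_edge (p q : I -> F) (i : I) := exists a b,
  [/\ (a != 0) || (b != 0), a * p i + b * q i = 0
    & forall j, 0 <= a * p j + b * q j].

(** A point annihilated by the [i]-th form is a multiple of [(- q i, p i)], where the [j]-th form
    has the value [det2 p q i j]; the sign of the multiple selects the alternative. *)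
Lemma is_edgeE (p q : I -> F) (i : I) : (1 < #|I|)%N ->
  (forall i j, i != j -> det2 p q i j != 0) ->
  is_edge p q i <-> (forall j, j != i -> 0 < det2 p q i j) \/
                    (forall j, j != i -> det2 p q i j < 0).
Proof.
move=> I_gt1 D0.
have [k ki] : exists k, k != i.
  have : (0 < #|predC1 i|)%N by rewrite cardC1; case: #|I| I_gt1 => [|[]].
  by case/card_gt0P => k; exists k.
have pq0 : (p i != 0) || (q i != 0).
  have : det2 p q i k != 0 by rewrite D0 // eq_sym.
  apply: contraNT; rewrite negb_or !negbK /det2 => /andP[/eqP-> /eqP->].
  by rewrite !mul0r subrr.
split=> [[a [b [ab0 abi abP]]]|].
  have [t t0 tP] : exists2 t, t != 0 & forall j, a * p j + b * q j = t * det2 p q i j.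
    have [pi0|pi0] := eqVneq (p i) 0.
      have qi0 : q i != 0 by rewrite pi0 eqxx in pq0.
      have b0 : b = 0.
        by move/eqP: abi; rewrite pi0 mulr0 add0r mulf_eq0 (negbTE qi0) orbF => /eqP.
      exists (- a / q i); last by move=> j; rewrite /det2 b0 pi0; field.
      move: ab0; rewrite b0 eqxx orbF => a0.
      by rewrite mulf_neq0 ?oppr_eq0 ?invr_eq0.
    have aE : a = - b * q i / p i by rewrite -[a](mulfK pi0); congr (_ / _); lra.
    exists (b / p i); last by move=> j; rewrite /det2 aE; field.
    rewrite mulf_neq0 ?invr_eq0 //; apply: contraL ab0 => /eqP b0.
    by rewrite aE b0 oppr0 !mul0r eqxx.
  case: (ltrgtP t 0) t0 => // t0 _; [right|left] => j ji;
    have := abP j; rewrite tP ?(nmulr_rge0 _ t0) ?(pmulr_rge0 _ t0) => Dle;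
    by rewrite lt_neqAle Dle ?andbT ?D0 // eq_sym ?D0 // eq_sym.
case=> iP; [exists (- q i), (p i) | exists (q i), (- p i)]; split.
- by rewrite oppr_eq0 orbC.
- by ring.
- move=> j; have [->|/iP] := eqVneq j i; rewrite ?/det2; last lra.
  by rewrite mulNr mulrC addNr.
- by rewrite oppr_eq0 orbC.
- by ring.
- move=> j; have [->|/iP] := eqVneq j i; rewrite ?/det2; last lra.
  by rewrite mulNr mulrC subrr.
Qed.

(** Pairwise independence leaves two shapes: the cone is trivial and has no edge, or it is a sector
    bounded by two rays, one on each side, counted by [S] and [T]. *)
Lemma odd_edges (p q : I -> F) : (1 < #|I|)%N ->
  (forall i j, i != j -> det2 p q i j != 0) ->
  ~~ odd #|[set i | `[< is_edge p q i >]]|.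
Proof.
move=> I_gt1 D0.
pose S := [set i | [forall j, (j != i) ==> (0 < det2 p q i j)]].
pose T := [set i | [forall j, (j != i) ==> (det2 p q i j < 0)]].
have SP i : reflect (forall j, j != i -> 0 < det2 p q i j) (i \in S).
  rewrite inE; apply: (iffP forallP) => iP j; last exact/implyP/iP.
  by move: (iP j) => /implyP.
have TP i : reflect (forall j, j != i -> det2 p q i j < 0) (i \in T).
  rewrite inE; apply: (iffP forallP) => iP j; last exact/implyP/iP.
  by move: (iP j) => /implyP.
have detC i j : det2 p q i j = - det2 p q j i by rewrite /det2; ring.
have S1 : (#|S| <= 1)%N.
  apply/card_le1_eqP => i j /SP iP /SP jP; apply/eqP; apply/negPn/negP => ij.
  have := iP j ij; have := jP i; rewrite eq_sym ij => /(_ isT).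
  by rewrite detC oppr_gt0 => /lt_trans /[apply]; rewrite ltxx.
have T1 : (#|T| <= 1)%N.
  apply/card_le1_eqP => i j /TP iP /TP jP; apply/eqP; apply/negPn/negP => ij.
  have := iP j ij; have := jP i; rewrite eq_sym ij => /(_ isT).
  by rewrite detC oppr_lt0 => /lt_trans /[apply]; rewrite ltxx.
have ST : (0 < #|S|)%N = (0 < #|T|)%N.
  apply/card_gt0P/card_gt0P => -[i].
    by move=> /SP/(leftmost_rightmost I_gt1 D0)[l lT]; exists l; apply/TP.
  move=> /TP iT.
  (* Reflecting the plane exchanges left and right. *)
  have [i' j ij|j ji|l lS] := @leftmost_rightmost p (fun j => - q j) i I_gt1.
  - have := D0 _ _ ij; apply: contra_neq; rewrite /det2; lra.
  - have := iT _ ji; rewrite /det2; lra.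
  - exists l; apply/SP => j jl; have := lS _ jl; rewrite /det2; lra.
have -> : [set i | `[< is_edge p q i >]] = S :|: T.
  apply/setP => i; rewrite finset.in_setU inE; apply/asboolP/orP.
    by case/(is_edgeE i I_gt1 D0) => [/SP|/TP]; [left|right].
  by move=> iST; apply/(is_edgeE i I_gt1 D0); case: iST => [/SP|/TP]; [left|right].
have SIT : S :&: T = finset.set0.
  apply/setP => i; rewrite !inE; apply/negP => /andP[/forallP Si /forallP Ti].
  have : (0 < #|predC1 i|)%N by rewrite cardC1; case: #|I| I_gt1 => [|[]].
  case/card_gt0P => k ki; move: (Si k) (Ti k) => /implyP/(_ ki) + /implyP/(_ ki).
  by move=> /lt_trans /[apply]; rewrite ltxx.
rewrite finset.cardsU SIT cards0 subn0.
by case: #|S| #|T| S1 T1 ST => [|[|//]] [|[|//]].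
Qed.

End PlanarCone.

(** * Parity of facets hitting a ray *)

Section RayCounting.
Variable F : realFieldType.
Implicit Types (x : nat -> nat -> F) (l : nat -> F).

(* Here [x i j] is the [j]-th coordinate of the [i]-th vector. *)

Definition zero_hit m x := exists l,
  [/\ forall i, (i < m.+1)%N -> 0 <= l i, exists2 i, (i < m.+1)%N & l i != 0
    & forall j, (j < m)%N -> \sum_(i < m.+1) l i * x i j = 0].

(** The simplex on the first [m + 1] vectors meets the positive half of axis [m], axes being
    numbered from 0 and those beyond [m] ignored. *)
Definition ray_hit m x := exists l,
  [/\ forall i, (i < m.+1)%N -> 0 <= l i,
      forall j, (j < m)%N -> \sum_(i < m.+1) l i * x i j = 0
    & 0 < \sum_(i < m.+1) l i * x i m].

Definition facet_hit m x (i0 : nat) := exists l,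
  [/\ forall i, (i < m.+2)%N -> 0 <= l i, l i0 = 0,
      forall j, (j < m)%N -> \sum_(i < m.+2) l i * x i j = 0
    & 0 < \sum_(i < m.+2) l i * x i m].

(** Independence is required already in the first [#|S|] coordinates, so that one condition serves
    every dimension of the induction. *)
Definition general_position k d x := forall (S : {set 'I_k}) l,
  (#|S| <= d)%N -> (forall i : 'I_k, i \notin S -> l i = 0) ->
  (forall j, (j < #|S|)%N -> \sum_(i < k) l i * x i j = 0) ->
  forall i, (i < k)%N -> l i = 0.

Lemma facet_hit_last m x : facet_hit m x m.+1 <-> ray_hit m x.
Proof.
split=> -[l].
  case=> l_ge0 lm lx lray; exists l; split=> [i im|j jm|].
  - by rewrite l_ge0 // ltnS ltnW.
  - by rewrite -[RHS](lx j jm) [RHS]big_ord_recr /= lm mul0r addr0.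
  - by move: lray; rewrite big_ord_recr /= lm mul0r addr0.
case=> l_ge0 lx lray; pose l' i := if (i < m.+1)%N then l i else 0.
have l'E j : \sum_(i < m.+2) l' i * x i j = \sum_(i < m.+1) l i * x i j.
  rewrite big_ord_recr /= /l' ltnn mul0r addr0.
  by apply: eq_bigr => i _; rewrite ltn_ord.
exists l'; split=> [i _||j jm|].
- by rewrite /l'; case: ifP => // /l_ge0.
- by rewrite /l' ltnn.
- by rewrite l'E lx.
- by rewrite l'E.
Qed.

Lemma facet_hit_ext m x x' (i0 : nat) : (i0 < m.+2)%N ->
  (forall i, (i < m.+2)%N -> i != i0 -> x i = x' i) ->
  facet_hit m x i0 -> facet_hit m x' i0.
Proof.
move=> im xx' [l [l_ge0 l0 lx lray]].
have E j : \sum_(i < m.+2) l i * x' i j = \sum_(i < m.+2) l i * x i j.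
  apply: eq_bigr => i _; have [->|ii0] := eqVneq (i : nat) i0.
    by rewrite l0 !mul0r.
  by rewrite xx'.
by exists l; split=> // [j|]; rewrite E //; apply: lx.
Qed.

Lemma ray_hit_ext m x x' : (forall i, (i < m.+1)%N -> x i = x' i) ->
  ray_hit m x -> ray_hit m x'.
Proof.
move=> xx' [l [l_ge0 lx lray]].
have E j : \sum_(i < m.+1) l i * x' i j = \sum_(i < m.+1) l i * x i j.
  by apply: eq_bigr => i _; rewrite xx'.
by exists l; split=> // [j|]; rewrite E //; apply: lx.
Qed.

(** By general position a nontrivial relation in the first [m] coordinates has a nonzero sum in
    coordinate [m], whose sign selects the ray. *)
Lemma zero_hitE m x : general_position m.+1 m.+1 x ->
  (zero_hit m x <-> ray_hit m x \/ ray_hit m (fun i j => - x i j)) /\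
  ~ (ray_hit m x /\ ray_hit m (fun i j => - x i j)).
Proof.
move=> gp.
have l0 l : (forall j, (j < m.+1)%N -> \sum_(i < m.+1) l i * x i j = 0) ->
    forall i, (i < m.+1)%N -> l i = 0.
  move=> lx; apply: (gp finset.setT); rewrite ?finset.cardsT ?card_ord // => i.
  by rewrite inE.
have oppE l j : \sum_(i < m.+1) l i * - x i j = - \sum_(i < m.+1) l i * x i j.
  by rewrite -sumrN; apply: eq_bigr => i _; rewrite mulrN.
have some_neq0 l j : \sum_(i < m.+1) l i * x i j != 0 ->
    exists2 i, (i < m.+1)%N & l i != 0.
  move=> s0; case/boolP: [exists i : 'I_m.+1, l i != 0].
    by case/existsP => i li; exists (i : nat).
  rewrite negb_exists => /forallP lall; case/eqP: s0.
  by rewrite big1 // => i _; have /negPn/eqP-> := lall i; rewrite mul0r.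
split.
  split=> [[l [l_ge0 [i im li] lx]]|[]].
  - case: (ltrgtP 0 (\sum_(i < m.+1) l i * x i m)) => s.
    + by left; exists l.
    + right; exists l; split=> // [j jm|]; first by rewrite oppE lx // oppr0.
      by rewrite oppE oppr_gt0.
    + case/eqP: li; apply: l0 => // j; rewrite ltnS leq_eqVlt.
      by case/predU1P => [->|/lx].
  - case=> l [l_ge0 lx lray]; exists l; split=> //.
    by apply: (some_neq0 l m); rewrite gt_eqF.
  - case=> l [l_ge0 lx]; rewrite oppE oppr_gt0 => lray; exists l; split=> //.
      by apply: (some_neq0 l m); rewrite lt_eqF.
    by move=> j /lx; rewrite oppE => /eqP; rewrite oppr_eq0 => /eqP.
case=> -[l [l_ge0 lx l_ray]] [l' [l'_ge0 l'x]]; rewrite oppE oppr_gt0 => l'_ray.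
pose s := \sum_(i < m.+1) l i * x i m; pose s' := \sum_(i < m.+1) l' i * x i m.
(* As [s' < 0 < s], these weights give a nonnegative relation that cancels coordinate [m] too. *)
pose c i := - s' * l i + s * l' i.
have cE j : \sum_(i < m.+1) c i * x i j =
    - s' * \sum_(i < m.+1) l i * x i j + s * \sum_(i < m.+1) l' i * x i j.
  by rewrite !mulr_sumr -big_split; apply: eq_bigr => i _ /=; rewrite /c; ring.
have c0 : forall i, (i < m.+1)%N -> c i = 0.
  apply: l0 => j; rewrite ltnS leq_eqVlt => /predU1P[->|jm].
    by rewrite cE -/s -/s'; ring.
  have := l'x _ jm; rewrite oppE => /eqP; rewrite oppr_eq0 => /eqP l'0.
  by rewrite cE lx // l'0 !mulr0 addr0.
have [|i im] := some_neq0 l m; first by rewrite gt_eqF.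
apply/negP; rewrite negbK; have := c0 i im; rewrite /c => cl.
have h1 : 0 <= - s' * l i by rewrite mulr_ge0 ?l_ge0 // oppr_ge0 ltW.
have h2 : 0 <= s * l' i by rewrite mulr_ge0 ?l'_ge0 // ltW.
have : - s' * l i = 0 by lra.
by move/eqP; rewrite mulf_eq0 oppr_eq0 lt_eqF.
Qed.

(* The nonnegative relations between the first [m] coordinates of [m + 2]
   vectors form a planar cone, bounded by the hyperplanes [l i = 0] and cut by
   [\sum_i l i * x i m = 0]. *)
Lemma odd_facets m x : general_position m.+2 m.+1 x ->
  odd #|[set i : 'I_m.+2 | `[< facet_hit m x i >]]| = `[< zero_hit m.+1 x >].
Proof.
move=> gp.
have gp2 (i1 i2 : 'I_m.+2) l : i1 != i2 -> l i1 = 0 -> l i2 = 0 ->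
    (forall j, (j < m)%N -> \sum_(i < m.+2) l i * x i j = 0) ->
    forall i, (i < m.+2)%N -> l i = 0.
  move=> i12 l1 l2 lx.
  have cS : #|~: [set i1; i2]| = m.
    have := finset.cardsC [set i1; i2]; rewrite finset.cards2 i12 card_ord; lia.
  apply: (gp (~: [set i1; i2])); rewrite ?cS // => i.
  by rewrite !inE negbK => /orP[]/eqP->.
have gp1 (i1 : 'I_m.+2) l : l i1 = 0 ->
    (forall j, (j < m.+1)%N -> \sum_(i < m.+2) l i * x i j = 0) ->
    forall i, (i < m.+2)%N -> l i = 0.
  move=> l1 lx.
  have cS : #|~: [set i1]| = m.+1.
    have := finset.cardsC [set i1]; rewrite finset.cards1 card_ord; lia.
  apply: (gp (~: [set i1])); rewrite ?cS // => i.
  by rewrite !inE negbK => /eqP->.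
pose i1 : 'I_m.+2 := ord0; pose i2 : 'I_m.+2 := inord 1.
have i12 : i1 != i2 by rewrite -val_eqE /= inordK.
(* The two extra columns read off the coefficients at [i1] and [i2]. By [gp2] the matrix is
   invertible, and rows [em] and [em1] of its inverse span the plane of relations, with these two
   coefficients as parameters. *)
pose M : 'M[F]_m.+2 := \matrix_(i, j)
  if (j < m)%N then x i j else if j == m :> nat then (i == i1)%:R else (i == i2)%:R.
pose em : 'I_m.+2 := inord m; pose em1 : 'I_m.+2 := ord_max.
have emE : em = m :> nat by rewrite inordK // ltnW.
pose ext (u : 'rV[F]_m.+2) (i : nat) : F := u 0 (inord i).
have extE u (i : 'I_m.+2) : ext u i = u 0 i by rewrite /ext inord_val.
have uM (u : 'rV[F]_m.+2) (j : 'I_m.+2) : (u *m M) 0 j =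
    if (j < m)%N then \sum_(i < m.+2) ext u i * x i j
    else if j == m :> nat then u 0 i1 else u 0 i2.
  rewrite mxE; case: ifP => jm; first by apply: eq_bigr => i _; rewrite mxE jm extE.
  case: ifP => jm'; [rewrite (bigD1 i1) //=|rewrite (bigD1 i2) //=];
    rewrite mxE jm jm' eqxx mulr1 big1 ?addr0 // => i /negbTE ii;
    by rewrite mxE jm jm' ii mulr0.
have Munit : M \in unitmx.
  rewrite -row_free_unit; apply: inj_row_free => u uM0.
  apply/rowP => i; rewrite mxE -extE; apply: (gp2 i1 i2) => //.
  - have := congr1 (fun u : 'rV_m.+2 => u 0 em) uM0.
    by rewrite uM mxE emE ltnn eqxx extE.
  - have := congr1 (fun u : 'rV_m.+2 => u 0 em1) uM0.
    by rewrite uM mxE /= ltnNge leqnSn /= eqn_leq ltnn /= extE.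
  - move=> j jm; have jm2 : (j < m.+2)%N by lia.
    have := congr1 (fun u : 'rV_m.+2 => u 0 (Ordinal jm2)) uM0.
    by rewrite uM mxE /= jm.
pose pv : 'rV[F]_m.+2 := delta_mx 0 em *m invmx M.
pose qv : 'rV[F]_m.+2 := delta_mx 0 em1 *m invmx M.
pose lc a b (i : nat) := a * ext pv i + b * ext qv i.
have em_neq (j : 'I_m.+2) : (j < m)%N -> ((j == em) = false) * ((j == em1) = false).
  by move=> jm; split; apply/negbTE; rewrite -val_eqE /= ?emE; lia.
have pM (j : 'I_m.+2) : (pv *m M) 0 j = (j == em)%:R by rewrite mulmxKV // mxE.
have qM (j : 'I_m.+2) : (qv *m M) 0 j = (j == em1)%:R by rewrite mulmxKV // mxE.
have em12 : (em == em1) = false by apply/negbTE; rewrite -val_eqE /= emE; lia.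
have p1 : pv 0 i1 = 1 by have := pM em; rewrite uM emE ltnn !eqxx.
have q1 : qv 0 i1 = 0 by have := qM em; rewrite uM emE ltnn !eqxx em12.
have p2 : pv 0 i2 = 0.
  by have := pM em1; rewrite uM /= ltnNge leqnSn /= eqn_leq ltnn /= eq_sym em12.
have q2 : qv 0 i2 = 1.
  by have := qM em1; rewrite uM /= ltnNge leqnSn /= eqn_leq ltnn /= eqxx.
have lcE a b j : \sum_(i < m.+2) lc a b i * x i j =
    a * \sum_(i < m.+2) ext pv i * x i j + b * \sum_(i < m.+2) ext qv i * x i j.
  by rewrite !mulr_sumr -big_split; apply: eq_bigr => i _ /=; rewrite /lc; ring.
have lcx a b j : (j < m)%N -> \sum_(i < m.+2) lc a b i * x i j = 0.
  move=> jm; have jm2 : (j < m.+2)%N by lia.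
  have := pM (Ordinal jm2); rewrite uM em_neq //= jm => p0.
  have := qM (Ordinal jm2); rewrite uM em_neq //= jm => q0.
  by rewrite lcE p0 q0 !mulr0 addr0.
have lc0 a b : (forall i, (i < m.+2)%N -> lc a b i = 0) -> (a = 0) * (b = 0).
  move=> ab0; have := ab0 _ (ltn_ord i1); have := ab0 _ (ltn_ord i2).
  by rewrite /lc !extE p1 p2 q1 q2 !mulr1 !mulr0 addr0 add0r.
have lc_rel l : (forall j, (j < m)%N -> \sum_(i < m.+2) l i * x i j = 0) ->
    forall i, (i < m.+2)%N -> l i = lc (l i1) (l i2) i.
  move=> lx i im; apply/eqP; rewrite -subr_eq0; apply/eqP.
  apply: (gp2 i1 i2 (fun i => l i - lc (l i1) (l i2) i)) => //.
  - by rewrite /lc !extE p1 q1; ring.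
  - by rewrite /lc !extE p2 q2; ring.
  - move=> j jm; under eq_bigr => t _ do rewrite mulrBl.
    by rewrite sumrB lx // lcx // subrr.
pose p (o : option 'I_m.+2) :=
  if o is Some i then ext pv i else \sum_(i < m.+2) ext pv i * x i m.
pose q (o : option 'I_m.+2) :=
  if o is Some i then ext qv i else \sum_(i < m.+2) ext qv i * x i m.
have vanish a b o1 o2 : o1 != o2 -> a * p o1 + b * q o1 = 0 ->
    a * p o2 + b * q o2 = 0 -> (a = 0) * (b = 0).
  have none_some i : a * p None + b * q None = 0 ->
      a * p (Some i) + b * q (Some i) = 0 -> (a = 0) * (b = 0).
    move=> hN hi; apply: lc0; apply: (gp1 i) => // j; rewrite ltnS leq_eqVlt.
    by case/predU1P => [->|/lcx//]; rewrite lcE.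
  case: o1 o2 => [j1|] [j2|] //.
  - move=> j12 h1 h2; apply: lc0; apply: (gp2 j1 j2) => //.
    exact: lcx.
  - by move=> _ h1 h2; apply: (none_some j1).
  - by move=> _ h1 h2; apply: (none_some j2).
have I_gt1 : (1 < #|{: option 'I_m.+2}|)%N by rewrite card_option card_ord.
(* If two forms were dependent, the point [(- q o, p o)] of either would annihilate both, so
   [vanish] would make both forms zero; then [(1, 0)] contradicts [vanish]. *)
have D0 o1 o2 : o1 != o2 -> p o1 * q o2 - q o1 * p o2 != 0.
  move=> o12; apply/negP => /eqP d0.
  have h1 : - q o1 * p o1 + p o1 * q o1 = 0 by ring.
  have h2 : - q o1 * p o2 + p o1 * q o2 = 0 by rewrite -[RHS]d0; ring.
  have [/eqP + p10] := vanish _ _ _ _ o12 h1 h2; rewrite oppr_eq0 => /eqP q10.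
  have h3 : - q o2 * p o1 + p o2 * q o1 = 0 by rewrite p10 q10; ring.
  have h4 : - q o2 * p o2 + p o2 * q o2 = 0 by ring.
  have [/eqP + p20] := vanish _ _ _ _ o12 h3 h4; rewrite oppr_eq0 => /eqP q20.
  have h5 : 1 * p o1 + 0 * q o1 = 0 by rewrite p10 q10; ring.
  have h6 : 1 * p o2 + 0 * q o2 = 0 by rewrite p20 q20; ring.
  by have [/eqP] := vanish _ _ _ _ o12 h5 h6; rewrite oner_eq0.
(* Edges at [Some i] are facet hits, an edge at [None] is a zero hit, and their total is even. *)
have := odd_edges I_gt1 D0; rewrite (finset.cardsD1 None) oddD.
have -> : [set o | `[< is_edge p q o >]] :\ None =
    Some @: [set i : 'I_m.+2 | `[< facet_hit m x i >]].
  apply/setP => -[i|]; rewrite !inE /=; last first.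
    by apply/esym/negP => /finset.imsetP[].
  rewrite (mem_imset _ _ (@Some_inj _)) inE; apply/asboolP/asboolP.
  - case=> a [b [ab0 abi abP]]; exists (lc a b); split.
    + by move=> j jm; have := abP (Some (Ordinal jm)).
    + exact: abi.
    + exact: lcx.
    + rewrite lcE lt_neqAle (abP None) andbT eq_sym; apply/eqP => abN.
      have [a0 b0] := vanish a b (Some i) None isT abi abN.
      by rewrite a0 b0 eqxx in ab0.
  - case=> l [l_ge0 li lx lray]; exists (l i1), (l i2).
    have lE := lc_rel l lx.
    have lmE : \sum_(t < m.+2) l t * x t m = l i1 * p None + l i2 * q None.
      by rewrite -lcE; apply: eq_bigr => t _; rewrite lE.
    split.
    + rewrite -negb_and; apply/negP => /andP[/eqP a0 /eqP b0].
      by move: lray; rewrite lmE a0 b0 !mul0r addr0 ltxx.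
    + by rewrite -[RHS]li [RHS]lE.
    + case=> [j|]; last by rewrite -lmE ltW.
      by have := l_ge0 _ (ltn_ord j); rewrite lE.
rewrite (finset.card_imset _ (@Some_inj _)) inE.
have -> : `[< is_edge p q None >] = `[< zero_hit m.+1 x >].
  apply/asboolP/asboolP.
  - case=> a [b [ab0 abN abP]]; exists (lc a b); split.
    + by move=> j jm; have := abP (Some (Ordinal jm)).
    + case/boolP: [exists i : 'I_m.+2, lc a b i != 0].
        by case/existsP => i li; exists (i : nat).
      rewrite negb_exists => /forallP all0.
      have [i im|a0 b0] := lc0 a b; last by rewrite a0 b0 eqxx in ab0.
      by have /negPn/eqP := all0 (Ordinal im).
    + by move=> j; rewrite ltnS leq_eqVlt => /predU1P[->|/lcx//]; rewrite lcE.
  - case=> l [l_ge0 [i im li] lx]; exists (l i1), (l i2).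
    have lE := lc_rel l (fun j jm => lx j (ltnW jm)).
    have lmE : \sum_(t < m.+2) l t * x t m = l i1 * p None + l i2 * q None.
      by rewrite -lcE; apply: eq_bigr => t _; rewrite lE.
    split.
    + rewrite -negb_and; apply/negP => /andP[/eqP a0 /eqP b0].
      by move: li; rewrite lE // /lc a0 b0 !mul0r addr0 eqxx.
    + by rewrite -lmE lx.
    + case=> [j|]; last by rewrite -lmE lx.
      by have := l_ge0 _ (ltn_ord j); rewrite lE.
by case: `[< _ >] => /=; [rewrite negbK => ->|move=> /negbTE].
Qed.

End RayCounting.

(** * General position *)

Section Genericity.
Variable F : realFieldType.

(** Up to sign and the factor [G], this is the characteristic matrix of [- A *m invmx G] at [s]. *)
Lemma unitmx_perturb n (A G : 'M[F]_n) s : G \in unitmx ->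
  ~~ root (char_poly (- A *m invmx G)) s -> A + s *: G \in unitmx.
Proof.
move=> Gu; rewrite -eigenvalue_root_char /eigenvalue /eigenspace negbK kermx_eq0.
rewrite row_free_unit => Hu.
have -> : A + s *: G = - (- A *m invmx G - s%:M) *m G.
  by rewrite opprB mulmxBl mul_scalar_mx mulmxKV // opprK addrC.
by rewrite unitmx_mul Gu andbT -scaleN1r unitmxZ ?unitrN1.
Qed.

Lemma exists_nonroot (p : {poly F}) (e : F) : p != 0 -> 0 < e ->
  exists s, [/\ 0 < s, s < e & ~~ root p s].
Proof.
(* These are [size p] distinct candidates below [e], more than [p] can have roots. *)
move=> p0 e0; pose pts := [seq e / (i.+2)%:R | i <- iota 0 (size p)].
have [all_roots|/allPn[_ /mapP[i _ ->] nroot]] := boolP (all (root p) pts).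
  suff /(max_poly_roots p0 all_roots) : uniq pts by rewrite size_map size_iota ltnn.
  rewrite map_inj_uniq ?iota_uniq // => i j /(mulfI (lt0r_neq0 e0)) /invr_inj /eqP.
  by rewrite eqr_nat => /eqP [].
exists (e / (i.+2)%:R); rewrite divr_gt0 ?ltr0n // ltr_pdivrMr ?ltr0n //.
by split=> //; rewrite ltr_pMr // ltr1n.
Qed.

Variables (P : finType) (neg : P -> P).
Hypothesis negK : involutive neg.

(** [X] and [neg X] share a parameter on the moment curve and get opposite signs. A choice without
    antipodal pairs has distinct parameters, so its matrix is a Vandermonde matrix with signed
    rows. *)
Lemma exists_odd_moment_curve : exists g : P -> nat -> F,
  (forall X j, g (neg X) j = - g X j) /\
  forall r (f : 'I_r -> P), injective f -> (forall i j, f i != neg (f j)) ->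
    \matrix_(i, j < r) g (f i) j \in unitmx.
Proof.
pose rk (X : P) := nat_of_ord (enum_rank X).
have rk_inj : injective rk by move=> X Y /val_inj /enum_rank_inj.
pose sg X : F := if X == neg X then 0 else if (rk X < rk (neg X))%N then 1 else - 1.
pose tau X : F := (minn (rk X) (rk (neg X)))%:R.
exists (fun X j => sg X * tau X ^+ j); split=> [X j|r f f_inj fN].
  rewrite /tau negK minnC -mulNr; congr (_ * _).
  rewrite /sg negK eq_sym; case: eqVneq => [_|XN]; first by rewrite oppr0.
  have : rk X != rk (neg X) by apply: contra_neq XN => /rk_inj.
  by case: ltngtP => // _ _; rewrite opprK.
have sg0 i : sg (f i) != 0.
  by rewrite /sg (negbTE (fN i i)); case: ifP; rewrite ?oppr_eq0 oner_neq0.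
have -> : \matrix_(i, j < r) (sg (f i) * tau (f i) ^+ j) =
    diag_mx (\row_i sg (f i)) *m (Vandermonde r (\row_i tau (f i)))^T.
  by apply/matrixP => i j; rewrite mul_diag_mx !mxE.
rewrite unitmxE det_mulmx det_diag det_tr det_Vandermonde unitfE mulf_neq0 //.
  by apply/prodf_neq0 => i _; rewrite mxE.
apply/prodf_neq0 => i _; apply/prodf_neq0 => j ij; rewrite !mxE subr_eq0 eqr_nat.
have fij : f i != f j by apply: contraTneq ij => /f_inj ->; rewrite ltnn.
have neq X Y : X != Y -> rk X != rk Y by apply: contra_neq => /rk_inj.
have h1 := neq _ _ fij; have h2 := neq _ _ (fN i j); have h3 := neq _ _ (fN j i).
have h4 : rk (neg (f i)) != rk (neg (f j)).
  by apply: neq; rewrite (inj_eq (inv_inj negK)).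
move: h1 h2 h3 h4; lia.
Qed.

(** For each admissible choice of elements the bad [s] are roots of a monic polynomial; a nonroot of
    the finite product avoids them all. *)
Lemma generic_perturbation (v : P -> nat -> F) (d : nat) :
  exists g : P -> nat -> F, (forall X j, g (neg X) j = - g X j) /\
    forall e, 0 < e -> exists s, [/\ 0 < s, s < e &
      forall r (f : 'I_r -> P) (l : 'I_r -> F), (r <= d)%N ->
        injective f -> (forall i j, f i != neg (f j)) ->
        (forall j, (j < r)%N -> \sum_i l i * (v (f i) j + s * g (f i) j) = 0) ->
        forall i, l i = 0].
Proof.
have [g [gN gu]] := exists_odd_moment_curve; exists g; split=> // e e0.
pose Mx (w : P -> nat -> F) r (f : 'I_r -> P) := \matrix_(i, j < r) w (f i) j.
(* All [f] may be included: where [Mx g r f] is singular, [invmx] has a default value, but the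
   factor is still monic. *)
pose p := \prod_(r < d.+1) \prod_(f : {ffun 'I_r -> P})
  char_poly (- Mx v r f *m invmx (Mx g r f)).
have p0 : p != 0.
  by apply/prodf_neq0 => r _; apply/prodf_neq0 => f _;
     rewrite monic_neq0 // char_poly_monic.
have [s [s0 se nroot]] := exists_nonroot p0 e0; exists s; split=> //.
move=> r f l rd f_inj fN lE; pose r' : 'I_d.+1 := Ordinal (rd : (r < d.+1)%N).
pose ff : {ffun 'I_r' -> P} := [ffun i => f i].
have ffE : ff =1 f by move=> i; rewrite ffunE.
have : Mx v r' ff + s *: Mx g r' ff \in unitmx.
  apply: unitmx_perturb.
    apply: gu => [i j|i j]; rewrite ?ffE; first by move=> /f_inj.
    exact: fN.
  apply: contraNN nroot => hroot; rewrite rootE /p.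
  rewrite (bigD1 r') // (bigD1 ff) //= !hornerM.
  by move: hroot; rewrite rootE => /eqP ->; rewrite !mul0r.
move=> Mu i; pose u : 'rV[F]_r := \row_i l i.
have u0 : u *m (Mx v r' ff + s *: Mx g r' ff) = 0.
  apply/rowP => j; rewrite !mxE -[RHS](lE _ (ltn_ord j)).
  by apply: eq_bigr => t _; rewrite !mxE !ffE.
have : u = 0 by rewrite -(mulmxK Mu u) u0 mul0mx.
by move/rowP/(_ i); rewrite !mxE.
Qed.

Lemma exists_small (T : finType) (a b : T -> F) : (forall t, 0 < a t) ->
  exists2 e, 0 < e & forall s, 0 < s -> s < e -> forall t, 0 < a t + s * b t.
Proof.
move=> a0.
suff [e e0 eP] : exists2 e, 0 < e &
    forall s, 0 < s -> s < e -> forall t, t \in enum T -> 0 < a t + s * b t.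
  by exists e => // s s0 se t; apply: eP => //; rewrite mem_enum.
elim: (enum T) => [|t ts [e e0 eP]]; first by exists 1.
have bt0 : 0 < `|b t| + 1 by rewrite ltr_wpDl.
exists (Num.min e (a t / (`|b t| + 1))).
  by rewrite lt_min e0 divr_gt0.
move=> s s0; rewrite lt_min ltr_pdivlMr // => /andP[se sa] u.
rewrite inE => /predU1P[->|]; last exact: eP.
have := ler_norm (- b t); rewrite normrN -(ler_pM2l s0); lra.
Qed.

End Genericity.

(** * Chains of sign vectors *)

Definition sign_vector N := {ffun 'I_N -> option bool}.

Definition sign_neg N (X : sign_vector N) : sign_vector N :=
  [ffun t => omap negb (X t)].

Lemma sign_negK N : involutive (@sign_neg N).
Proof. by move=> X; apply/ffunP => t; rewrite !ffunE; case: (X t) => [[]|]. Qed.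

Lemma even_card_involution (T : finType) (f : T -> T) (A : {set T}) :
  (forall a, a \in A -> [/\ f a \in A, f (f a) = a & f a != a]) -> ~~ odd #|A|.
Proof.
have [n] := ubnP #|A|; elim: n A => // n IH A An fA.
have [->|[a aA]] := finset.set_0Vmem A; first by rewrite finset.cards0.
have [faA ffa fa] := fA a aA.
rewrite (finset.cardsD1 a) aA (finset.cardsD1 (f a)) !inE fa faA /= negbK.
apply: IH => [|b].
  by move: An; rewrite (finset.cardsD1 a) aA (finset.cardsD1 (f a)) !inE fa faA /=; lia.
rewrite !inE => /and3P[bfa ba bA]; have [fbA ffb fb] := fA b bA.
split=> //; rewrite fbA andbT; apply/andP; split.
  by apply: contra_neq ba => fbfa; rewrite -ffb fbfa ffa.
by apply: contra_neq bfa => fba; rewrite -ffb fba.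
Qed.

Section SignedPermutations.
Variable n : nat.
Local Notation N := n.+1.

(* [(s, b)] encodes the maximal chain of sign vectors that gives the
   coordinates [s 0, s 1, ...] successively their signs [b (s 0), b (s 1), ...]. *)
Definition signed_perm : finType := ({perm 'I_N} * {ffun 'I_N -> bool})%type.
Implicit Types c : signed_perm.

Definition prefix c (k : nat) : sign_vector N :=
  [ffun t => if ((c.1^-1)%g t < k)%N then Some (c.2 t) else None].

(* The chains whose first [k] members are supported on the first [k]
   coordinates, with a positive sign at each coordinate from [m] on. *)
Definition initial k m : {set signed_perm} :=
  [set c : signed_perm | [forall t : 'I_N, (k <= t)%N ==> (c.1 t == t)] &&
    [forall t : 'I_N, (m <= t)%N ==> c.2 t]].

Lemma initialP k m c : reflect
  ((forall t : 'I_N, (k <= t)%N -> c.1 t = t) /\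
   (forall t : 'I_N, (m <= t)%N -> c.2 t)) (c \in initial k m).
Proof.
rewrite inE; apply: (iffP andP) => -[cs cb].
  split=> t; first by move/forallP: cs => /(_ t)/implyP h /h/eqP.
  by move/forallP: cb => /(_ t)/implyP.
by split; apply/forallP => t; apply/implyP => ht; rewrite ?cs ?cb.
Qed.

Lemma initial_lt k m c (t : 'I_N) : c \in initial k m ->
  ((c.1^-1)%g t < k)%N = (t < k)%N.
Proof.
case/initialP => cs _; apply/idP/idP; apply: contraTT; rewrite -!leqNgt => h.
  by rewrite -[X in (c.1^-1)%g X]cs // permK.
by have := cs _ h; rewrite permKV => ->.
Qed.

(** For consecutive positions, the chain across the facet that drops the member between the two
    additions. *)
Definition swap (i j : 'I_N) c : signed_perm := ((tperm i j * c.1)%g, c.2).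

(** For the coordinate added last, the chain across the facet that drops the last member. *)
Definition flip (a : 'I_N) c : signed_perm :=
  (c.1, [ffun t => if t == a then ~~ c.2 t else c.2 t]).

Definition antipode m c : signed_perm :=
  (c.1, [ffun t : 'I_N => if (t <= m)%N then ~~ c.2 t else c.2 t]).

Lemma swapK i j : involutive (swap i j).
Proof. by case=> s b; rewrite /swap /= mulgA tperm2 mul1g. Qed.

Lemma flipK a : involutive (flip a).
Proof.
case=> s b; congr pair; apply/ffunP => t; rewrite !ffunE /=.
by case: eqP => // _; rewrite negbK.
Qed.

Lemma antipodeK m : involutive (antipode m).
Proof.
case=> s b; congr pair; apply/ffunP => t; rewrite !ffunE /=.
by case: leqP => // _; rewrite negbK.
Qed.

Lemma prefix_swap (i j : 'I_N) c l : j = i.+1 :> nat -> l != i.+1 ->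
  prefix (swap i j c) l = prefix c l.
Proof.
move=> ij li; apply/ffunP => t; rewrite !ffunE /= invMg permM tpermV.
congr (if _ then _ else _); case: tpermP => // ->; rewrite ij; lia.
Qed.

Lemma prefix_flip (a : 'I_N) c l : (l <= a)%N ->
  prefix (flip (c.1 a) c) l = prefix c l.
Proof.
move=> la; apply/ffunP => t; rewrite !ffunE /=; case: ifP => // tl; congr Some.
by case: eqP tl => // ->; rewrite permK ltnNge la.
Qed.

Lemma prefix_antipode m c l : c \in initial m.+1 m.+1 -> (l <= m.+1)%N ->
  prefix (antipode m c) l = sign_neg (prefix c l).
Proof.
move=> cm lm; apply/ffunP => t; rewrite !ffunE /=; case: ifP => //= tl.
by have := leq_trans tl lm; rewrite (initial_lt t cm) ltnS => ->.
Qed.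

Lemma prefix_inj c k1 k2 : (k1 <= N)%N -> (k2 <= N)%N ->
  prefix c k1 = prefix c k2 -> k1 = k2.
Proof.
wlog: k1 k2 / (k1 < k2)%N => [hw k1N k2N E|k12 _ k2N].
  case: (ltngtP k1 k2) => // h; first exact: hw.
  by apply/esym/hw.
move=> /ffunP /(_ (c.1 (Ordinal (leq_trans k12 k2N)))).
by rewrite !ffunE permK /= ltnn k12.
Qed.

Lemma prefix_neq_neg c k1 k2 : prefix c k1.+1 != sign_neg (prefix c k2.+1).
Proof.
apply/eqP => /ffunP /(_ (c.1 ord0)); rewrite !ffunE permK /=.
by case: (c.2 _).
Qed.

Lemma card_initial0 : #|initial 1 0| = 1%N.
Proof.
rewrite (_ : initial 1 0 = [set (1%g, [ffun=> true])]) ?finset.cards1 //.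
apply/setP => -[s b]; rewrite !inE -[LHS]/(_ && _).
apply/idP/eqP => [|[-> ->]]; last first.
  by apply/andP; split; apply/forallP => t; apply/implyP => _;
     rewrite ?perm1 ?ffunE.
move=> H; have /initialP[/= ss bb] : (s, b) \in initial 1 0 by rewrite inE.
congr pair; last by apply/ffunP => t; rewrite ffunE bb.
apply/permP => t; rewrite perm1; case: (posnP t) => [t0|/ss//].
case: (posnP (s t)) => [st0|/ss/perm_inj//].
by apply: val_inj; rewrite /= st0 t0.
Qed.

End SignedPermutations.

(** * Parity of the chains whose simplex contains the origin *)

Section OddCount.
Variables (F : realFieldType) (n : nat) (v : sign_vector n.+1 -> nat -> F).
Hypothesis v_odd : forall X j, v (sign_neg X) j = - v X j.
Hypothesis v_generic : forall r (f : 'I_r -> sign_vector n.+1) (l : 'I_r -> F),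
  (r <= n)%N -> injective f -> (forall i j, f i != sign_neg (f j)) ->
  (forall j, (j < r)%N -> \sum_i l i * v (f i) j = 0) -> forall i, l i = 0.

Let x (c : signed_perm n) i := v (prefix c i.+1).

(** The members of a chain are distinct and agree in sign at the coordinate added first, so none are
    antipodal and [v_generic] applies. *)
Lemma general_position_chain c k d : (k <= n.+1)%N -> (d <= n)%N ->
  general_position k d (x c).
Proof.
move=> kN dn S l Sd lS lx i ik.
have [iS|/lS//] := boolP (Ordinal ik \in S).
pose f (a : 'I_#|S|) := prefix c (enum_val a).+1.
have f_inj : injective f.
  move=> a b /prefix_inj fab; apply/enum_val_inj/val_inj.
  by have [] := fab (leq_trans (ltn_ord _) kN) (leq_trans (ltn_ord _) kN).
have := @v_generic _ f (fun a => l (enum_val a)) (leq_trans Sd dn) f_inj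
  (fun a b => prefix_neq_neg c _ _) _ (enum_rank_in iS (Ordinal ik)).
rewrite enum_rankK_in //; apply=> j jS; rewrite -[RHS](lx j jS).
rewrite [RHS](bigID (mem S)) /= [X in _ + X]big1 ?addr0 => [|t /lS->]; last first.
  by rewrite mul0r.
by rewrite [RHS]big_enum_val.
Qed.

(** The left side runs over a sphere, the right side over its hemisphere with positive sign at
    coordinate [m]. The antipode carries the other hemisphere to this one and the ray to its
    opposite, and a zero hit is a hit of exactly one of the two rays. *)
Lemma card_ray_chains m : (m < n)%N ->
  #|[set c in initial n m.+1 m.+1 | `[< ray_hit m (x c) >]]| =
  #|[set c in initial n m.+1 m | `[< zero_hit m (x c) >]]|.
Proof.
move=> mn; pose em : 'I_n.+1 := inord m.
have emE : em = m :> nat by rewrite inordK // ltnW.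
have initE c : (c \in initial n m.+1 m) = (c \in initial n m.+1 m.+1) && c.2 em.
  apply/initialP/andP => [[cs cb]|[/initialP[cs cb] cm]].
    split; last by apply: cb; rewrite emE.
    by apply/initialP; split=> // t /ltnW /cb.
  split=> // t; rewrite leq_eqVlt => /orP[/eqP mt|/cb//].
  by rewrite (_ : t = em) //; apply: val_inj; rewrite /= emE.
have anti_init c : (antipode m c \in initial n m.+1 m.+1) = (c \in initial n m.+1 m.+1).
  apply/initialP/initialP => -[cs cb]; split=> // t mt; have := cb t mt;
    by rewrite /= ?ffunE leqNgt mt.
have anti_em c : (antipode m c).2 em = ~~ c.2 em by rewrite ffunE emE leqnn.
pose mx c : nat -> nat -> F := fun i j => - x c i j.
have xA c i : c \in initial n m.+1 m.+1 -> (i < m.+1)%N -> x (antipode m c) i = mx c i.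
  by move=> cm im; apply/funext => j; rewrite /mx /x prefix_antipode.
pose A := [set c in initial n m.+1 m | `[< ray_hit m (x c) >]].
pose B := [set c in initial n m.+1 m | `[< ray_hit m (mx c) >]].
have zh c := zero_hitE (@general_position_chain c m.+1 m.+1 (ltnW mn) mn).
have -> : [set c in initial n m.+1 m | `[< zero_hit m (x c) >]] = A :|: B.
  apply/setP => c; rewrite finset.in_setU !finset.in_set -andb_orr; congr andb.
  apply/asboolP/orP => [/(zh c).1[]|]; first by left; apply/asboolP.
    by right; apply/asboolP.
  by move=> h; apply/(zh c).1; case: h => /asboolP; [left|right].
have -> : [set c in initial n m.+1 m.+1 | `[< ray_hit m (x c) >]] =
    A :|: (antipode m @: B).
  rewrite (finset.can2_imset_pre _ (@antipodeK n m) (@antipodeK n m)).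
  apply/setP => c; rewrite finset.in_setU finset.inE [in RHS]inE [c \in _ @^-1: _]inE.
  rewrite [antipode m c \in B]inE !initE anti_init anti_em.
  case: (boolP (c \in _)) => //= cm; case: (c.2 em); rewrite /= ?orbF //.
  apply/asboolP/asboolP; apply: ray_hit_ext => i im; apply/funext => j;
    rewrite /mx (xA c i cm im) /mx opprK //.
have AB0 : A :&: B = finset.set0.
  apply/setP => c; rewrite !inE; apply/negP => /andP[/andP[_ /asboolP cA] /andP[_ /asboolP cB]].
  by have [_ []] := zh c.
rewrite !finset.cardsU AB0 finset.card_imset; last exact: inv_inj (@antipodeK n m).
congr (_ - _)%N; rewrite finset.cards0; apply/eqP; rewrite finset.cards_eq0.
apply/eqP/setP => c; rewrite finset.in_setI finset.in_set0 [c \in A]inE.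
apply/negP => /andP[/andP[cA _] /finset.imsetP[d]].
rewrite inE => /andP[dB _] cd; move: cA dB.
by rewrite cd !initE anti_em => /andP[_ /negP dem] /andP[].
Qed.

Lemma odd_facet_chains m : (m < n)%N ->
  odd #|[set c in initial n m.+2 m.+1 | `[< zero_hit m.+1 (x c) >]]| =
  odd #|[set p : signed_perm n * 'I_m.+2 | (p.1 \in initial n m.+2 m.+1) &&
          `[< facet_hit m (x p.1) p.2 >]]|.
Proof.
move=> mn; set H := initial n m.+2 m.+1.
have -> : #|[set p : signed_perm n * 'I_m.+2 | (p.1 \in H) &&
          `[< facet_hit m (x p.1) p.2 >]]| =
    (\sum_(c in H) #|[set i : 'I_m.+2 | `[< facet_hit m (x c) i >]]|)%N.
  under [RHS]eq_bigr => c _ do rewrite -sum1dep_card.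
  by rewrite pair_big_dep /= sum1dep_card.
have -> : #|[set c in H | `[< zero_hit m.+1 (x c) >]]| =
    (\sum_(c in H) `[< zero_hit m.+1 (x c) >])%N.
  by rewrite -sum1dep_card big_mkcondr; apply: eq_bigr => c _; case: `[< _ >].
rewrite !(big_morph odd oddD (erefl _)); apply: eq_bigr => c _.
by rewrite odd_facets ?oddb //; apply: general_position_chain.
Qed.

(* Dropping the [i]-th member of a chain leaves a facet of exactly one other
   chain, except for the boundary facets, which are the maximal chains of the
   next smaller sphere. *)
Lemma odd_boundary m : (m < n)%N ->
  odd #|[set p : signed_perm n * 'I_m.+2 | (p.1 \in initial n m.+2 m.+1) &&
          `[< facet_hit m (x p.1) p.2 >]]| =
  odd #|[set c in initial n m.+1 m.+1 | `[< ray_hit m (x c) >]]|.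
Proof.
move=> mn; set H := initial n m.+2 m.+1; set S := finset _.
pose em : 'I_n.+1 := inord m.+1.
have emE : em = m.+1 :> nat by rewrite inordK.
have initE c : (c \in initial n m.+1 m.+1) = (c \in H) && (c.1 em == em).
  apply/initialP/andP => [[cs cb]|[/initialP[cs cb] /eqP cm]].
    split; last by rewrite cs // emE.
    by apply/initialP; split=> // t /ltnW /cs.
  split=> // t; rewrite leq_eqVlt => /orP[/eqP mt|/cs//].
  by rewrite (_ : t = em) //; apply: val_inj; rewrite /= emE.
(* A boundary pair drops the last member of a chain that adds coordinate [m + 1] last. *)
pose bd := [set p : signed_perm n * 'I_m.+2 | (p.2 == ord_max) && (p.1.1 em == em)].
have in_S c i : ((c, i) \in S) = (c \in H) && `[< facet_hit m (x c) i >].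
  by rewrite finset.in_set.
have in_bd c i : ((c, i) \in bd) = (i == ord_max) && (c.1 em == em).
  by rewrite finset.in_set.
rewrite -(finset.cardsID bd S) oddD.
have -> : S :&: bd = [set (c, ord_max : 'I_m.+2) |
    c in [set c in initial n m.+1 m.+1 | `[< ray_hit m (x c) >]]].
  apply/setP => -[c i]; rewrite finset.in_setI in_S in_bd; apply/idP/finset.imsetP.
    case/andP=> /andP[cH /asboolP ci] /andP[/eqP im cm]; exists c; last by rewrite im.
    rewrite inE initE cH cm /=; apply/asboolP/facet_hit_last.
    by move: ci; rewrite im.
  case=> c'; rewrite inE initE => /andP[/andP[cH cm] /asboolP cr] [-> ->].
  by rewrite cH cm eqxx /= andbT; apply/asboolP/facet_hit_last.
rewrite finset.card_imset => [|c c' []//].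
suff /negbTE -> : ~~ odd #|S :\: bd| by rewrite addbF.
pose o (i : nat) : 'I_n.+1 := inord i.
have oE i : (i < m.+2)%N -> o i = i :> nat by move=> im; rewrite inordK //; lia.
(* The neighbouring chain across the facet. If the last member is dropped, the coordinate added last
   is not [em] outside [bd], so its sign is free in [H]. *)
pose f (p : signed_perm n * 'I_m.+2) : signed_perm n * 'I_m.+2 :=
  (if p.2 == ord_max then flip (p.1.1 em) p.1 else swap (o p.2) (o p.2.+1) p.1, p.2).
have ord_lt (i : 'I_m.+2) : i != ord_max -> (i < m.+1)%N.
  by move=> im; move: (ltn_ord i); rewrite ltnS leq_eqVlt => /orP[/eqP ii|//];
     case/eqP: im; apply: val_inj.
apply: (@even_card_involution _ f) => -[c i].
rewrite finset.in_setD in_S in_bd => /andP[nbd /andP[cH /asboolP ci]].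
have [cs cb] := initialP _ _ _ cH.
rewrite /f /=; case: eqVneq => [im|im].
  have cem : c.1 em != em by move: nbd; rewrite im eqxx.
  have cem_lt : (c.1 em < m.+1)%N.
    rewrite ltnNge; apply: contra cem => h.
    have [/cs/perm_inj ->//|] := leqP m.+2 (c.1 em).
    by move=> h2; apply/eqP/val_inj/eqP; rewrite /= emE eqn_leq -ltnS h2 h.
  split; last 1 first.
  - rewrite xpair_eqE eqxx andbT; apply/eqP => /(congr1 snd) /ffunP /(_ (c.1 em)).
    by rewrite /= ffunE eqxx; case: (c.2 _).
  - rewrite finset.in_setD in_S in_bd /= im eqxx cem /=; apply/andP; split.
      apply/initialP; split=> // t mt; rewrite /= ffunE cb //.
      by case: eqP => // tc; rewrite -tc ltnNge mt in cem_lt.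
    apply/asboolP; rewrite im /= in ci; apply: (facet_hit_ext (ltnSn m.+1) _ ci).
    by move=> j jm ji; apply/esym/funext => k; rewrite /x prefix_flip // emE; lia.
  - by rewrite /= flipK.
have im1 := ord_lt _ im.
have oi : o i.+1 = (o i).+1 :> nat by rewrite !oE //; lia.
split; last 1 first.
- rewrite xpair_eqE eqxx andbT; apply/eqP => /(congr1 fst) /= /(canRL (mulgK _)).
  rewrite mulgV => /permP /(_ (o i)); rewrite tpermL perm1 => /(congr1 val) /=.
  by rewrite oi; lia.
- rewrite finset.in_setD in_S in_bd /= (negbTE im) /=; apply/andP; split.
    apply/initialP; split=> // t mt; rewrite permM tpermD ?cs //.
      by rewrite -val_eqE /= oE //; lia.
    by rewrite -val_eqE /= oE //; lia.
  apply/asboolP; apply: (facet_hit_ext (ltn_ord i) _ ci).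
  move=> j jm ji; apply/esym/funext => k; rewrite /x prefix_swap //.
  by rewrite oE.
- by rewrite /= swapK.
Qed.

(** Induction on the dimension of the hemisphere: zero hits become facet hits, then, as inner facets
    cancel, ray hits on the boundary sphere, and by antipodality zero hits on its hemisphere. For
    [m = 0] the only chain is a hit, as there are no equations. *)
Lemma odd_zero_chains m : (m <= n)%N ->
  odd #|[set c in initial n m.+1 m | `[< zero_hit m (x c) >]]|.
Proof.
elim: m => [_|m IH mn].
  rewrite (_ : [set c in _ | _] = initial n 1 0) ?card_initial0 //.
  apply/setP => c; rewrite finset.in_set andb_idr // => _; apply/asboolP.
  by exists (fun=> 1); split=> //; exists 0%N; rewrite ?oner_neq0.
by rewrite odd_facet_chains // odd_boundary // card_ray_chains // IH // ltnW.
Qed.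

End OddCount.

(** * Borsuk-Ulam and sign-constant relations *)

(* [v] extends affinely along chains to an odd map from the boundary of the
   cross-polytope of dimension [n + 1] to [F^n]. *)
Theorem octahedral_borsuk_ulam (F : realFieldType) (n : nat)
    (v : sign_vector n.+1 -> nat -> F) :
  (forall X j, v (sign_neg X) j = - v X j) ->
  exists c : signed_perm n, zero_hit n (fun i => v (prefix c i.+1)).
Proof.
move=> v_odd; apply: contrapT => /forallNP nohit.
(* A chain without a hit has a functional strictly positive on its members. Small perturbations of
   [v] keep these inequalities, so a generic one contradicts the odd count. *)
have /choice[y yP] : forall c : signed_perm n, exists y : 'rV[F]_n,
    forall i : 'I_n.+1, 0 < \sum_(j < n) v (prefix c i.+1) j * y 0 j.
  move=> c; pose h (i : 'I_n.+1) : 'rV[F]_n := \row_j v (prefix c i.+1) j.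
  have [[y yP]|[l [l_ge0 _ [i li] lx]]] := gordan xpredT h.
    exists y => i; apply: (lt_le_trans (yP i isT)).
    by rewrite le_eqVlt; apply/orP; left; apply/eqP/eq_bigr => j _; rewrite mxE.
  case: (nohit c); exists (fun i => l (inord i)); split=> [t _||j jn].
  - exact: l_ge0.
  - by exists (i : nat); rewrite ?inord_val.
  - have := congr1 (fun u : 'rV_n => u 0 (Ordinal jn)) lx.
    rewrite summxE mxE => lj; rewrite -[RHS]lj; apply: eq_bigr => t _.
    by rewrite !mxE inord_val.
have [g [g_odd gP]] := generic_perturbation (@sign_negK n.+1) v n.
pose ev (w : sign_vector n.+1 -> nat -> F) (t : signed_perm n * 'I_n.+1) :=
  \sum_(j < n) w (prefix t.1 t.2.+1) j * y t.1 0 j.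
have [e e0 eP] := @exists_small F _ (ev v) (ev g) (fun t => yP t.1 t.2).
have [s [s0 se sP]] := gP e e0.
pose v' X j := v X j + s * g X j.
have v'_odd X j : v' (sign_neg X) j = - v' X j.
  by rewrite /v' v_odd g_odd mulrN opprD.
have := odd_zero_chains v'_odd sP (leqnn n).
have [->|[c]] := finset.set_0Vmem
  [set c in initial n n.+1 n | `[< zero_hit n (fun i => v' (prefix c i.+1)) >]].
  by rewrite finset.cards0.
rewrite inE => /andP[_ /asboolP[l [l_ge0 [i im li] lx]]] _.
have : \sum_(j < n) y c 0 j * (\sum_(i < n.+1) l i * v' (prefix c i.+1) j) = 0.
  by rewrite big1 // => j _; rewrite lx ?mulr0.
have -> : \sum_(j < n) y c 0 j * (\sum_(i < n.+1) l i * v' (prefix c i.+1) j) =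
    \sum_(i < n.+1) l i * (ev v (c, i) + s * ev g (c, i)).
  under eq_bigr => j _ do rewrite mulr_sumr.
  rewrite exchange_big; apply: eq_bigr => t _ /=.
  rewrite /ev /= [s * _]mulr_sumr -big_split mulr_sumr; apply: eq_bigr => j _ /=.
  by rewrite /v'; ring.
move/eqP; rewrite psumr_eq0 => [|t _]; last first.
  by rewrite mulr_ge0 ?l_ge0 // ltW // eP.
move/allP/(_ (Ordinal im) (mem_index_enum _)); rewrite /= mulf_eq0 (negbTE li) /=.
by rewrite gt_eqF // eP.
Qed.

Section RowsOrColumns.
Variable F : realFieldType.

Definition dot d (a b : 'rV[F]_d) : F := \sum_j a 0 j * b 0 j.

Lemma dotZl d s (a b : 'rV[F]_d) : dot (s *: a) b = s * dot a b.
Proof. by rewrite /dot mulr_sumr; apply: eq_bigr => j _; rewrite mxE mulrA. Qed.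

Lemma dotBr d (a b c : 'rV[F]_d) : dot a (b - c) = dot a b - dot a c.
Proof.
by rewrite /dot -sumrB; apply: eq_bigr => j _; rewrite !mxE mulrDr mulrN.
Qed.

Lemma dot_sumr d m (l : 'I_m -> F) (a : 'rV[F]_d) (b : 'I_m -> 'rV[F]_d) :
  dot a (\sum_k l k *: b k) = \sum_k l k * dot a (b k).
Proof.
rewrite /dot; under [RHS]eq_bigr => k _ do rewrite mulr_sumr.
rewrite [RHS]exchange_big; apply: eq_bigr => j _ /=.
rewrite summxE mulr_sumr; apply: eq_bigr => k _.
by rewrite !mxE; ring.
Qed.

Lemma dot0r d (a : 'rV[F]_d) : dot a 0 = 0.
Proof. by rewrite /dot big1 // => j _; rewrite mxE mulr0. Qed.

Definition sign_val (o : option bool) : F :=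
  if o is Some b then if b then 1 else -1 else 0.

Lemma sign_val_inj b b' (a : F) :
  0 < sign_val (Some b) * a -> 0 < sign_val (Some b') * a -> b = b'.
Proof. by case: b; case: b' => //= h1 h2; exfalso; lra. Qed.

(** The products make the nonzero coefficients of a row agree in sign without choosing that sign. *)
Definition row_signed_relation p q d (y : 'I_p -> 'I_q -> 'rV[F]_d) :=
  exists W : 'I_p -> 'I_q -> F,
    [/\ forall i j j', 0 <= W i j * W i j', exists i j, W i j != 0
      & \sum_i \sum_j W i j *: y i j = 0].

(* [u X] is a functional that takes on the points of each row [i] with
   [X i != None] the sign prescribed by [X i]. *)
Definition row_separating p q d (y : 'I_p -> 'I_q -> 'rV[F]_d)
    (u : sign_vector p -> 'rV[F]_d) :=
  (forall X, u (sign_neg X) = - u X) /\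
  forall (X : sign_vector p) i j, X i != None ->
    0 < sign_val (X i) * dot (y i j) (u X).

(** Gordan's alternative is applied to the points multiplied by their row signs; a nonnegative
    relation among these is row-signed once the signs move to the coefficients. *)
Lemma row_separation p q d (y : 'I_p -> 'I_q -> 'rV[F]_d) :
  ~ row_signed_relation y -> exists u, row_separating y u.
Proof.
move=> norel.
have /choice[h hP] : forall X : sign_vector p, exists h : 'rV[F]_d,
    forall i j, X i != None -> 0 < sign_val (X i) * dot (y i j) h.
  move=> X; have [[h hP]|[l [l_ge0 lP [[i j] lij] l0]]] := gordan
      (fun t : 'I_p * 'I_q => X t.1 != None)
      (fun t => sign_val (X t.1) *: y t.1 t.2).
    by exists h => i j Xi; rewrite -dotZl; exact: hP (i, j) Xi.
  case: norel; exists (fun i j => l (i, j) * sign_val (X i)); split.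
  - by move=> a b b'; rewrite mulrACA -expr2 mulr_ge0 ?sqr_ge0 // mulr_ge0.
  - exists i, j; rewrite mulf_neq0 //.
    have : X i != None by apply: contraNT lij => /(lP (i, j)) ->.
    by case: (X i) => [[]|//] _; rewrite /= ?oppr_eq0 oner_neq0.
  - rewrite -[RHS]l0 pair_big; apply: eq_bigr => -[a b] _ /=.
    by rewrite scalerA.
(* Antisymmetrizing gives oddness; [- h (sign_neg X)] satisfies the same inequalities as [h X]. *)
exists (fun X => h X - h (sign_neg X)); split=> [X|X i j Xi].
  by rewrite sign_negK opprB.
rewrite dotBr mulrBr subr_gt0; apply: lt_trans (hP X i j Xi).
have := hP (sign_neg X) i j; rewrite ffunE.
by case: (X i) Xi => [[]|//] _ /= /(_ isT); rewrite mul1r mulN1r ?oppr_gt0 //; lra.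
Qed.

(* The smallest nonzero member with a nonzero coefficient prescribes the signs
   of the combination, since all other members extend it. *)
Lemma separating_chain p q d (y : 'I_p -> 'I_q -> 'rV[F]_d) u m
    (X : nat -> sign_vector p) (l : 'I_m -> F) :
  row_separating y u -> (forall k, 0 <= l k) ->
  (forall k k' i, (k <= k')%N -> X k i != None -> X k' i = X k i) ->
  (exists k, l k != 0 /\ exists i, X k i != None) ->
  exists k0, [/\ l k0 != 0, exists i, X k0 i != None,
    forall k : 'I_m, (k < k0)%N -> l k != 0 -> forall i, X k i = None
    & forall i j, X k0 i != None ->
        0 < sign_val (X k0 i) * dot (y i j) (\sum_k l k *: u (X k))].
Proof.
move=> [u_odd uP] l_ge0 Xmono [k1 [lk1 [i1 Xk1]]].
pose nz (k : 'I_m) := (l k != 0) && [exists i, X k i != None].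
have nz1 : nz k1 by rewrite /nz lk1; apply/existsP; exists i1.
have [k0 /andP[lk0 /existsP Xk0] k0_min] := @arg_minnP _ k1 nz (@nat_of_ord m) nz1.
have small (k : 'I_m) : (k < k0)%N -> l k != 0 -> forall i, X k i = None.
  move=> kk0 lk i; apply/eqP; apply: contraTT kk0 => Xki; rewrite -leqNgt.
  by apply: k0_min; rewrite /nz lk; apply/existsP; exists i.
have u0 (Z : sign_vector p) : (forall i, Z i = None) -> u Z = 0.
  move=> Z0; have ZN : sign_neg Z = Z by apply/ffunP => i; rewrite !ffunE Z0.
  have := u_odd Z; rewrite ZN => /eqP.
  rewrite -addr_eq0 -mulr2n -scaler_nat scaler_eq0 pnatr_eq0 /=.
  by move/eqP.
exists k0; split=> // i j Xi; rewrite dot_sumr mulr_sumr.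
have term (k : 'I_m) : 0 <= sign_val (X k0 i) * (l k * dot (y i j) (u (X k))).
  have [->|lk] := eqVneq (l k) 0; first by rewrite mul0r mulr0.
  have [kk0|k0k] := ltnP k k0; first by rewrite u0 ?dot0r ?mulr0 //; exact: small.
  have Xk := Xmono _ _ _ k0k Xi.
  by rewrite mulrCA -Xk mulr_ge0 // ltW // uP // Xk.
rewrite (bigD1 k0) //= ltr_pwDl ?sumr_ge0 // mulrCA mulr_gt0 ?uP //.
by rewrite lt_neqAle eq_sym lk0 l_ge0.
Qed.

(** Zero exactly if both signs occur or none does, and otherwise the common sign. *)
Definition balance p (X : sign_vector p) : F :=
  [exists i, X i == Some true]%:R - [exists i, X i == Some false]%:R.

Lemma balance_neg p (X : sign_vector p) : balance (sign_neg X) = - balance X.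
Proof.
rewrite /balance opprB; congr (_%:R - _%:R); congr (nat_of_bool _);
  by apply: eq_existsb => i; rewrite ffunE; case: (X i) => [[]|].
Qed.

Lemma balance_none p (X : sign_vector p) : (forall i, X i = None) -> balance X = 0.
Proof.
move=> X0; have exF b : [exists i, X i == Some b] = false.
  by apply/negbTE/existsPn => i; rewrite X0.
by rewrite /balance !exF subrr.
Qed.

Lemma balance_ge0 p (X : sign_vector p) i b :
  X i = Some b -> 0 <= sign_val (Some b) * balance X.
Proof.
move=> Xi; have exb : [exists i, X i == Some b] by apply/existsP; exists i; rewrite Xi.
rewrite /balance; case: (b) exb => /= ->; case: [exists _, _];
  by rewrite ?subrr ?subr0 ?sub0r ?mulr0 ?mulrNN ?mulr1 ?ler01.
Qed.

Lemma balance_eq1 p (X : sign_vector p) i b : X i = Some b ->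
  (forall i', X i' != None -> X i' = Some b) -> sign_val (Some b) * balance X = 1.
Proof.
move=> Xi Xb; have exb : [exists i, X i == Some b] by apply/existsP; exists i; rewrite Xi.
have exN : [exists i, X i == Some (~~ b)] = false.
  apply/negbTE/existsPn => i'; apply/eqP => Xi'; have := Xb i'; rewrite Xi'.
  by move=> /(_ isT) []; case: (b).
by rewrite /balance; case: (b) exb exN => /= -> ->;
  rewrite ?subr0 ?sub0r ?mulrNN ?mulr1.
Qed.

Lemma prefix_mono n (c : signed_perm n) k k' t : (k <= k')%N ->
  prefix c k t != None -> prefix c k' t = prefix c k t.
Proof.
by rewrite !ffunE => kk'; case: ifP => // /leq_trans -> //.
Qed.

Theorem rows_or_columns p q d (y : 'I_p -> 'I_q -> 'rV[F]_d) :
  (0 < p)%N -> (0 < q)%N -> (p + q = d.+2)%N ->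
  row_signed_relation y \/ row_signed_relation (fun j i => y i j).
Proof.
move=> p0 q0 pq; apply: contrapT => /not_orP[/row_separation[u uS] /row_separation[w wS]].
pose X (Z : sign_vector d.+2) : sign_vector p :=
  [ffun i => Z (cast_ord pq (lshift q i))].
pose Y (Z : sign_vector d.+2) : sign_vector q :=
  [ffun j => Z (cast_ord pq (rshift p j))].
have XE Z i : X Z i = Z (cast_ord pq (lshift q i)) by rewrite ffunE.
have YE Z j : Y Z j = Z (cast_ord pq (rshift p j)) by rewrite ffunE.
have XN Z : X (sign_neg Z) = sign_neg (X Z) by apply/ffunP => i; rewrite !ffunE.
have YN Z : Y (sign_neg Z) = sign_neg (Y Z) by apply/ffunP => i; rewrite !ffunE.
(* Of the [d + 1] coordinates needed, the first [d] compare the functionals; [insub] fails at the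
   last, [j = d], which holds the balance. *)
pose v (Z : sign_vector d.+2) (j : nat) : F :=
  if insub j is Some j' then (u (X Z) - w (Y Z)) 0 j' else balance (X Z).
have v_odd Z j : v (sign_neg Z) j = - v Z j.
  rewrite /v XN YN; case: insub => [j'|]; last exact: balance_neg.
  by rewrite uS.1 wS.1 !mxE; ring.
have [c [l' [l'_ge0 [k' k'm l'k'] lx]]] := octahedral_borsuk_ulam v_odd.
pose l (k : 'I_d.+2) := l' k; pose Z k := prefix c k.+1.
have l_ge0 k : 0 <= l k by apply: l'_ge0.
have uw : \sum_k l k *: u (X (Z k)) = \sum_k l k *: w (Y (Z k)).
  apply/eqP; rewrite -subr_eq0 -sumrB; apply/eqP/rowP => j; rewrite summxE [RHS]mxE.
  rewrite -[RHS](lx j (ltnW (ltn_ord j))); apply: eq_bigr => k _.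
  by rewrite /v valK !mxE /l; ring.
have bal0 : \sum_k l k * balance (X (Z k)) = 0.
  rewrite -[RHS](lx d (ltnSn d)); apply: eq_bigr => k _.
  by rewrite /v insubF ?ltnn.
have Xmono k1 k2 i : (k1 <= k2)%N -> X (Z k1) i != None -> X (Z k2) i = X (Z k1) i.
  by rewrite !XE => k12; apply: prefix_mono.
have Ymono k1 k2 i : (k1 <= k2)%N -> Y (Z k1) i != None -> Y (Z k2) i = Y (Z k1) i.
  by rewrite !YE => k12; apply: prefix_mono.
have Xch := @separating_chain _ _ _ _ _ _ (X \o Z) l uS l_ge0 Xmono.
have Ych := @separating_chain _ _ _ _ _ _ (Y \o Z) l wS l_ge0 Ymono.
(* An odd map vanishes at the zero sign vector, so an absent half of the join contributes
   nothing. *)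
have trivial_sum r (u' : sign_vector r -> 'rV[F]_d) (X' : nat -> sign_vector r) :
    (forall T, u' (sign_neg T) = - u' T) ->
    ~ (exists k, l k != 0 /\ exists i, X' k i != None) ->
    \sum_k l k *: u' (X' k) = 0.
  move=> u'_odd none; apply: big1 => k _.
  have [->|lk] := eqVneq (l k) 0; first by rewrite scale0r.
  have XkN : sign_neg (X' k) = X' k.
    apply/ffunP => i; rewrite ffunE; case E : (X' k i) => [b|//].
    by case: none; exists k; split=> //; exists i; rewrite E.
  have := u'_odd (X' k); rewrite XkN => /eqP.
  rewrite -addr_eq0 -mulr2n -scaler_nat scaler_eq0 pnatr_eq0 /= => /eqP ->.
  by rewrite scaler0.
have [exX|noX] := pselect (exists k, l k != 0 /\ exists i, (X \o Z) k i != None);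
  have [exY|noY] := pselect (exists k, l k != 0 /\ exists i, (Y \o Z) k i != None).
(* On column [j1] the common functional has sign [b], so all signs of the first nonzero row part are
   [b]. The balance is nonzero there and never opposite later, so its weighted sum cannot vanish. *)
- have [k0 [lk0 [i0 Xi0] small Xpos]] := Xch exX.
  have [k1 [lk1 [j1 Yj1] _ Ypos]] := Ych exY.
  have [b Yb] : exists b, (Y \o Z) k1 j1 = Some b.
    by case: ((Y \o Z) k1 j1) Yj1 => // b; exists b.
  have Xb i : (X \o Z) k0 i != None -> (X \o Z) k0 i = Some b.
    move=> Xi; have := Xpos i j1 Xi; have := Ypos j1 i Yj1; rewrite -uw Yb.
    by case: ((X \o Z) k0 i) Xi => // b' _ h1 /(sign_val_inj h1) ->.
  have term k : 0 <= sign_val (Some b) * (l k * balance (X (Z k))).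
    have [->|lk] := eqVneq (l k) 0; first by rewrite mul0r mulr0.
    rewrite mulrCA mulr_ge0 //; have [kk0|k0k] := ltnP k k0.
      by rewrite balance_none ?mulr0 //; exact: small.
    apply: (@balance_ge0 _ _ i0); rewrite (Xmono _ _ _ k0k Xi0); exact: Xb.
  have : 0 < sign_val (Some b) * \sum_k l k * balance (X (Z k)).
    rewrite mulr_sumr (bigD1 k0) //= ltr_pwDl ?sumr_ge0 // mulrCA.
    rewrite -[X in _ * X]/(sign_val (Some b) * balance (X (Z k0))).
    rewrite (@balance_eq1 _ _ i0) //; last exact: Xb.
    by rewrite mulr1 lt_neqAle eq_sym lk0 l_ge0.
  by rewrite bal0 mulr0 ltxx.
(* Without column signs the functional is zero, yet it is strictly signed on a row, which has a
   point as [0 < q]. *)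
- have [k0 [lk0 [i0 Xi0] _ Xpos]] := Xch exX.
  have := Xpos i0 (Ordinal q0) Xi0; rewrite uw.
  by rewrite (trivial_sum _ _ (Y \o Z) wS.1 noY) dot0r mulr0 ltxx.
- have [k0 [lk0 [j0 Yj0] _ Ypos]] := Ych exY.
  have := Ypos j0 (Ordinal p0) Yj0; rewrite -uw.
  by rewrite (trivial_sum _ _ (X \o Z) uS.1 noX) dot0r mulr0 ltxx.
(* The coordinate added first is signed in every member and belongs to a row or a column. *)
- have Zt : Z k' (c.1 ord0) != None by rewrite /Z ffunE permK.
  have := Zt; rewrite -[c.1 ord0](cast_ordKV pq).
  case: (splitP (cast_ord (esym pq) (c.1 ord0))) => [i|j] E.
  + rewrite (_ : cast_ord _ _ = lshift q i); last exact: val_inj.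
    move=> Zi; apply: noX; exists (Ordinal k'm); split=> //; exists i.
    by rewrite /= XE.
  + rewrite (_ : cast_ord _ _ = rshift p j); last exact: val_inj.
    move=> Zi; apply: noY; exists (Ordinal k'm); split=> //; exists j.
    by rewrite /= YE.
Qed.

End RowsOrColumns.

(** * Transversals *)

Lemma vspace_extend (F : fieldType) (vT : vectType F) (U : {vspace vT}) (k : nat) :
  (\dim U <= k <= \dim {:vT})%N -> exists2 V : {vspace vT}, (U <= V)%VS & \dim V = k.
Proof.
case/andP=> Uk kn; pose X : seq vT := take (k - \dim U) (vbasis (U^C)%VS).
have X_free : free X.
  apply: (@catl_free _ _ (drop (k - \dim U) (vbasis (U^C)%VS))).
  by rewrite cat_take_drop (basis_free (vbasisP _)).
have UX : (U :&: <<X>> = 0)%VS.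
  apply/eqP; rewrite -subv0 -(capv_compl U) capvS //.
  by rewrite -[X in (_ <= X)%VS](span_basis (vbasisP _)) sub_span // => v /mem_take.
exists (U + <<X>>)%VS; first exact: addvSl.
rewrite dimv_disjoint_sum // (eqP X_free) size_take_min size_tuple dimv_compl; lia.
Qed.

(** A second point with nonzero coefficient lies in the affine span of the others, so [k] directions
    from [y i0] suffice; [vspace_extend] makes the dimension exactly [k]. *)
Lemma flat_of_affine_dependence (R : realType) (n k : nat) (y : 'I_k.+2 -> 'rV[R]_n)
    (l : 'I_k.+2 -> R) :
  (k <= n)%N -> \sum_i l i = 0 -> \sum_i l i *: y i = 0 -> (exists i, l i != 0) ->
  exists2 L, is_flat k L & forall i, L (y i).
Proof.
move=> kn l0 ly [i0 li0].
have [i1 i10 li1] : exists2 i1, i1 != i0 & l i1 != 0.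
  apply: contrapT => none; case/eqP: li0; move: l0; rewrite (bigD1 i0) //= big1 ?addr0 //.
  by move=> i ii0; apply/eqP/negPn/negP => li; apply: none; exists i.
pose X := [seq y i - y i0 | i <- enum (~: [set i0; i1])].
have sX : size X = k.
  rewrite size_map -cardE; have := finset.cardsC [set i0; i1].
  by rewrite finset.cards2 eq_sym i10 card_ord; lia.
have [|V XV dV] := @vspace_extend _ _ <<X>>%VS k.
  by rewrite dimvf [dim _]mul1n kn andbT -sX dim_span.
exists [set y i0 + v | v in [set v | v \in V]]%classic; first by exists (y i0), V.
have yX i : i != i0 -> i != i1 -> y i - y i0 \in V.
  move=> ii0 ii1; apply: (subvP XV); apply/memv_span/map_f.
  by rewrite mem_enum !inE negb_or ii0.
move=> i; exists (y i - y i0); last by rewrite addrC subrK.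
rewrite /mkset /=; have [->|ii0] := eqVneq i i0; first by rewrite subrr mem0v.
have [->|ii1] := eqVneq i i1; last exact: yX.
have : \sum_i l i *: (y i - y i0) = 0.
  under eq_bigr => t _ do rewrite scalerBr.
  by rewrite sumrB -scaler_suml l0 ly scale0r subrr.
rewrite (bigD1 i1) //= => /eqP; rewrite addr_eq0 => /eqP E.
rewrite -(scalerK li1 (y i1 - y i0)) E memvZ // memvN memv_suml // => t ti1.
have [->|ti0] := eqVneq t i0; first by rewrite subrr scaler0 mem0v.
by rewrite memvZ // yX.
Qed.

Lemma convex_set_sum (R : realType) (n m : nat) (K : set 'rV[R]_n) (a : 'I_m -> R)
    (x : 'I_m -> 'rV[R]_n) : convex_set K -> (forall i, K (x i)) ->
  (forall i, 0 <= a i) -> \sum_i a i = 1 -> K (\sum_i a i *: x i).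
Proof.
move=> Kc Kx a_ge0 a1.
have Kseg u w t : K u -> K w -> 0 <= t -> t <= 1 -> K (t *: u + (1 - t) *: w).
  move=> Ku Kw t0 t1.
  exact: set_mem (Kc u w (Itv01 t0 t1) (mem_set Ku) (mem_set Kw)).
suff : forall r, (r <= m)%N -> 0 < \sum_(i < m | (i < r)%N) a i ->
    K ((\sum_(i < m | (i < r)%N) a i)^-1 *: \sum_(i < m | (i < r)%N) a i *: x i).
  move=> /(_ m (leqnn m)).
  have E : (fun i : 'I_m => (i < m)%N) =1 xpredT by move=> i; rewrite ltn_ord.
  by rewrite !(eq_bigl _ _ E) a1 invr1 scale1r => /(_ ltr01).
elim=> [_|r IH rm]; first by rewrite big_pred0_eq ltxx.
pose e := Ordinal rm.
have recE (V : nmodType) (f : 'I_m -> V) :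
    \sum_(i < m | (i < r.+1)%N) f i = \sum_(i < m | (i < r)%N) f i + f e.
  rewrite (bigD1 e) //= addrC; congr (_ + _); apply: eq_bigl => j.
  by rewrite -val_eqE /=; lia.
rewrite !recE; set s := \sum_(i < m | _) a i; set u := \sum_(i < m | _) _ => sa.
have s_ge0 : 0 <= s by apply: sumr_ge0.
have [s0|s0] := eqVneq s 0.
  have -> : u = 0.
    apply: big1 => i ir; suff -> : a i = 0 by rewrite scale0r.
    by apply/eqP; rewrite eq_le a_ge0 andbT -s0 /s (bigD1 i) //= lerDl sumr_ge0.
  move: sa; rewrite s0 !add0r => sa.
  by rewrite scalerA mulVf ?scale1r // gt_eqF.
have s_gt0 : 0 < s by rewrite lt_neqAle eq_sym s0.
have := Kseg _ _ (s / (s + a e)) (IH (ltnW rm) s_gt0) (Kx e).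
rewrite -/s -/u divr_ge0 ?(ltW sa) // ler_pdivrMr // mul1r lerDl a_ge0.
move=> /(_ isT isT); congr (K _).
rewrite scalerDr !scalerA; congr (_ *: _ + _ *: _); field;
  by rewrite ?s0 lt0r_neq0.
Qed.

(** Dividing the coefficients of a row by their sum [l i] gives a convex combination [y i] in [A i].
    The appended coordinate 1 makes the relation an affine dependence of the [y i] with coefficients
    [l i]. *)
Lemma transversal_of_relation (R : realType) (n k q : nat)
    (A : 'I_k.+2 -> set 'rV[R]_n) (x : 'I_k.+2 -> 'I_q.+1 -> 'rV[R]_n) :
  (k <= n)%N -> (forall i, convex_set (A i)) -> (forall i j, A i (x i j)) ->
  row_signed_relation (fun i j => row_mx (x i j) (1 : 'rV[R]_1)) ->
  exists2 L, is_flat k L & forall i, exists2 z, L z & A i z.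
Proof.
move=> kn Ac Ax [W [W_sign [i0 [j0 Wij0]] Wx]].
pose l i := \sum_j W i j.
have W_l i j : 0 <= W i j * l i by rewrite mulr_sumr sumr_ge0.
have l_eq0 i : l i = 0 -> forall j, W i j = 0.
  move=> li j; have := li => /(congr1 ( *%R (W i j))); rewrite mulr0 mulr_sumr => /eqP.
  rewrite psumr_eq0 // => /allP/(_ j (mem_index_enum _)) /=.
  by rewrite mulf_eq0 orbb => /eqP.
(* A zero sum forces the whole row of coefficients to vanish, so any point of [A i] will do. *)
pose y i := if l i == 0 then x i ord0 else \sum_j (W i j / l i) *: x i j.
have Ay i : A i (y i).
  rewrite /y; case: ifPn => // li; apply: convex_set_sum => // [j|].
    rewrite (_ : _ / _ = W i j * l i / l i ^+ 2); last by field.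
    by rewrite divr_ge0 ?sqr_ge0.
  by rewrite -mulr_suml divff.
have lyE i : l i *: y i = \sum_j W i j *: x i j.
  rewrite /y; have [li|li] := eqVneq (l i) 0.
    by rewrite li scale0r big1 // => j _; rewrite l_eq0 ?scale0r.
  rewrite scaler_sumr; apply: eq_bigr => j _; rewrite scalerA; congr (_ *: _).
  by field.
have ly0 : \sum_i l i *: y i = 0.
  under eq_bigr => i _ do rewrite lyE.
  transitivity (lsubmx (0 : 'rV[R]_(n + 1))); last by rewrite linear0.
  rewrite -Wx linear_sum; apply: eq_bigr => i _.
  by rewrite linear_sum; apply: eq_bigr => j _; rewrite linearZ /= row_mxKl.
have l0 : \sum_i l i = 0.
  transitivity (rsubmx (0 : 'rV[R]_(n + 1)) 0 0); last by rewrite linear0 mxE.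
  rewrite -Wx linear_sum summxE; apply: eq_bigr => i _.
  rewrite linear_sum summxE; apply: eq_bigr => j _.
  by rewrite linearZ /= row_mxKr !mxE mulr1.
have [L Lf Ly] : exists2 L, is_flat k L & forall i, L (y i).
  apply: (@flat_of_affine_dependence _ _ _ y l) => //.
  by exists i0; apply: contra_neq Wij0 => /l_eq0.
by exists L => // i; exists (y i).
Qed.

Lemma indexed_family_without_transversal (R : realType) (n k : nat)
    (F : set (set 'rV[R]_n)) : (k <= n)%N ->
  ~ every_subfamily_has_transversal k (k + 2) F ->
  exists A : 'I_k.+2 -> set 'rV[R]_n, (forall i, F (A i)) /\
    ~ exists2 L, is_flat k L & forall i, exists2 z, L z & A i z.
Proof.
move=> kn /existsNP[G /not_implyP[GF /not_implyP[Gcard noL]]].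
(* An empty [G] admits any [k]-flat; otherwise [k + 2] indices surject onto it, with repetitions if
   it is smaller. *)
have [G0|[g]] := pfcard_geP Gcard.
  case: noL; have [|V _ dV] := @vspace_extend _ _ (0%VS : {vspace 'rV[R]_n}) k.
    by rewrite dimv0 dimvf [dim _]mul1n.
  exists [set 0 + v | v in [set v | v \in V]]%classic; split; first by exists 0, V.
  by rewrite G0.
exists (fun i : 'I_k.+2 => g i); split=> [i|[L Lf LA]].
  by apply/GF/funS => /=; rewrite addn2.
case: noL; exists L; split=> // K /(@surj _ _ _ _ g)[i /= ik <-].
have ik2 : (i < k.+2)%N by rewrite -(addn2 k).
by have [z Lz gz] := LA (Ordinal ik2); exists z.
Qed.

Local Open Scope classical_set_scope.

Theorem theorem8p3 (R : realType) (n k : nat)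
    (hn : n = (2 * k + 1)%N) (hn3 : (3 <= n)%N)
    (F1 F2 : set (set 'rV[R]_n))
    (hF1 : forall K, F1 K -> convex_set K /\ compact K)
    (hF2 : forall K, F2 K -> convex_set K /\ compact K) :
  (exists K1 K2, [/\ F1 K1, F2 K2 & K1 `&` K2 = set0]) \/
  (every_subfamily_has_transversal k (k + 2) F1 \/
   every_subfamily_has_transversal k (k + 2) F2).
Proof.
apply: contrapT => /not_orP[meet /not_orP[no1 no2]].
have kn : (k <= n)%N by lia.
have [A [FA noA]] := indexed_family_without_transversal kn no1.
have [B [FB noB]] := indexed_family_without_transversal kn no2.
have AB i j : exists z, (A i `&` B j) z.
  apply/set0P/eqP => AB0; apply: meet.
  by exists (A i), (B j); split.
pose x i j := projT1 (cid (AB i j)).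
have xA i j : A i (x i j) by rewrite /x; case: cid => z [].
have xB i j : B j (x i j) by rewrite /x; case: cid => z [].
(* The dimension count: [(k + 2) + (k + 2) = (n + 1) + 2] since [n = 2k + 1]. *)
have [|||row_rel|col_rel] :=
  @rows_or_columns R k.+2 k.+2 (n + 1) (fun i j => row_mx (x i j) (1 : 'rV[R]_1)).
- by [].
- by [].
- by rewrite hn; lia.
- by apply: noA; apply: transversal_of_relation row_rel => // i; case: (hF1 _ (FA i)).
- apply: noB; apply: (@transversal_of_relation _ _ _ _ B (fun j i => x i j)) => //.
  by move=> j; case: (hF2 _ (FB j)).
Qed.
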